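(* Let $G$ be an infinite, residually finite, boundedly generated group. Then the rank gradient of $G$ is zero, that is, $$\inf_{H} \frac{\mathrm{rank}(H)-1}{[G : H]} = 0,$$ where $H$ runs over all subgroups of finite index in $G$.
   Context: A group $G$ is called boundedly generated if there exist a positive integer $m$ and elements $g_1, \dots, g_m \in G$ such that $G = \langle g_1 \rangle \cdots \langle g_m \rangle$ as sets, i.e. every element of $G$ can be written as $g_1^{a_1} \cdots g_m^{a_m}$ for some integers $a_1, \dots, a_m$. The rank $\mathrm{rank}(H)$ of a group $H$ is the smallest cardinality of a generating set of $H$. A group is residually finite if the intersection of its finite index subgroups is trivial (equivalently, it is Hausdorff in its profinite topology). *)

(* Defs.v *)
From HB Require Import structures.
From mathcomp Require Import all_boot all_order all_algebra finmap.
From mathcomp Require Import boolp classical_sets functions cardinality.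
From mathcomp Require Import reals constructive_ereal ereal.

Set Implicit Arguments.
Unset Strict Implicit.
Unset Printing Implicit Defensive.

Import Order.TTheory GRing.Theory Num.Theory.

Local Open Scope classical_set_scope.

(* Groups are MathComp's [groupType], which may be infinite; subsets of a group
   are classical sets. *)

Definition expgz (G : groupType) (x : G) (a : int) : G :=
  match a with
  | Posz n => (x ^+ n)%g
  | Negz n => (x ^- n.+1)%g
  end.

Definition boundedly_generated (G : groupType) : Prop :=
  exists (m : nat) (g : 'I_m -> G), (0 < m)%N /\
    forall x : G, exists a : 'I_m -> int,
      x = \big[*%g/1%g]_(i < m) expgz (g i) (a i).

Definition subgroup (G : groupType) (H : set G) : Prop :=
  group_closed [in H].

Definition lcosets (G : groupType) (H : set G) : set (set G) :=
  [set [set (x * h)%g | h in H] | x in [set: G]].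

Definition finite_index_subgroup (G : groupType) (H : set G) : Prop :=
  subgroup H /\ finite_set (lcosets H).

(* [G : H]; [fset_set] sends an infinite set to the empty one, so this is
   only meaningful for [H] of finite index. *)
Definition subgroup_index (G : groupType) (H : set G) : nat :=
  #|` fset_set (lcosets H) |.

Definition residually_finite (G : groupType) : Prop :=
  \bigcap_(H in [set H : set G | finite_index_subgroup H]) H = [set 1%g].

Definition generated (G : groupType) (S : set G) : set G :=
  smallest (@subgroup G) S.

Local Open Scope ereal_scope.

(* The least cardinality of a generating set of [H], with value +oo when [H]
   has no finite generating set ([ereal_inf set0 = +oo]). *)
Definition rank (R : realType) (G : groupType) (H : set G) : \bar R :=
  ereal_inf [set (#|` fset_set S |%:R)%:E
            | S in [set S : set G | finite_set S /\ generated S = H]].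

Definition rank_gradient (R : realType) (G : groupType) : \bar R :=
  ereal_inf [set (rank R H - 1) / ((subgroup_index H)%:R)%:E
            | H in [set H : set G | finite_index_subgroup H]].

(* Main.v *)
Require Import Defs.
From HB Require Import structures.
From mathcomp Require Import all_boot all_order all_algebra finmap.
From mathcomp Require Import boolp classical_sets functions cardinality.
From mathcomp Require Import reals constructive_ereal ereal.

Import Order.TTheory GRing.Theory Num.Theory.

Local Open Scope group_scope.
Local Open Scope classical_set_scope.

(* Ranks of finite index subgroups are bounded along a family of unbounded index.
   Let H have large finite index, and let k > 0 be such that z^k lies in H for
   all z. Writing a_j = r_j + k q_j with 0 <= r_j < k, the product of the
   g_j^(a_j) is an element of L_r p_m, where p_j = g_1^(r_1) ... g_j^(r_j) and
   L_r is generated by the m elements p_(j-1) g_j^k p_(j-1)^-1 of H. So G is the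
   union of finitely many cosets of the L_r, and by B. H. Neumann's lemma some
   L_r has finite index. It has rank at most m and is contained in H. *)

(** * Subgroups, cosets and finite index *)

Lemma subgroup1 {G : groupType} (H : set G) : subgroup H -> H 1.
Proof. by case; rewrite inE. Qed.

Lemma subgroupV {G : groupType} (H : set G) x : subgroup H -> H x -> H x^-1.
Proof. by move=> /group_closedV hH Hx; have := hH x; rewrite !inE; apply. Qed.

Lemma subgroupM {G : groupType} (H : set G) x y :
  subgroup H -> H x -> H y -> H (x * y).
Proof.
by move=> /group_closedM hH Hx Hy; have := hH x y; rewrite !inE; apply.
Qed.

Lemma subgroupX {G : groupType} (H : set G) x n :
  subgroup H -> H x -> H (x ^+ n).
Proof.
move=> hH Hx; elim: n => [|n IHn]; first exact: subgroup1.
by rewrite expgS; apply: subgroupM.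
Qed.

Lemma subgroup_intro {G : groupType} (H : set G) :
  H 1 -> (forall x, H x -> H x^-1) -> (forall x y, H x -> H y -> H (x * y)) ->
  subgroup H.
Proof.
move=> H1 HV HM; split; first by rewrite inE.
by move=> x y; rewrite !inE => Hx Hy; apply: HM => //; apply: HV.
Qed.

Lemma subgroup_preimJ {G : groupType} (H : set G) (z : G) :
  subgroup H -> subgroup [set x | H (x ^ z)].
Proof.
move=> hH; apply: subgroup_intro => /= [|x|x y].
- by rewrite conj1g; apply: subgroup1.
- by rewrite conjVg; apply: subgroupV.
- by rewrite conjMg; apply: subgroupM.
Qed.

Lemma subgroup_setI {G : groupType} (H K : set G) :
  subgroup H -> subgroup K -> subgroup (H `&` K).
Proof.
move=> hH hK; apply: subgroup_intro => [|x [Hx Kx]|x y [Hx Kx] [Hy Ky]].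
- by split; apply: subgroup1.
- by split; apply: subgroupV.
- by split; apply: subgroupM.
Qed.

Lemma subgroup_set1 {G : groupType} : subgroup [set 1 : G].
Proof.
by apply: subgroup_intro => //= [x ->|x y -> ->]; rewrite ?invg1 ?mulg1.
Qed.

Lemma subgroup_generated {G : groupType} (S : set G) : subgroup (generated S).
Proof.
apply: subgroup_intro => [|x Sx|x y Sx Sy] L [hL SL].
- exact: subgroup1.
- by apply: subgroupV => //; apply: Sx.
- by apply: subgroupM => //; [apply: Sx|apply: Sy].
Qed.

Lemma lcoset_eq {G : groupType} (H : set G) (x y : G) : subgroup H ->
  [set x * h | h in H] = [set y * h | h in H] <-> H (x^-1 * y).
Proof.
move=> hH; split=> [exy|Hxy].
  have: [set x * h | h in H] y.
    by rewrite exy; exists 1; [apply: subgroup1|rewrite mulg1].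
  by case=> h Hh <-; rewrite mulKg.
apply/seteqP; split=> _ [h Hh <-] /=.
  exists ((x^-1 * y)^-1 * h); first by apply: subgroupM => //; apply: subgroupV.
  by rewrite invgM invgK !mulgA mulgV mul1g.
exists (x^-1 * y * h); first exact: subgroupM.
by rewrite !mulgA mulgV mul1g.
Qed.

Lemma finite_indexP {G : groupType} (H : set G) : subgroup H ->
  finite_set (lcosets H) <->
  exists F : seq G, forall x, exists2 a, a \in F & H (a^-1 * x).
Proof.
move=> hH; split=> [/finite_seqP[s es]|[F hF]]; last first.
  have -> : lcosets H = [set [set a * h | h in H] | a in [set` F]].
    apply/seteqP; split=> _ [x _ <-]; last by exists x.
    by have [a aF Hax] := hF x; exists a => //; apply/lcoset_eq.
  exact/finite_image/finite_seq.
pose rep (A : set G) := xget 1 [set x | [set x * h | h in H] = A].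
exists [seq rep A | A <- s] => x; pose A := [set x * h | h in H].
exists (rep A).
  by apply/map_f; have : [set` s] A by rewrite -es; exists x.
apply/lcoset_eq => //.
by rewrite /rep; case: xgetP => [y _ -> //|/(_ x)]; case.
Qed.

(** A coset of the intersection is the intersection of a coset of [H] and a coset of [K], so
    finitely many pairs account for all of them. *)
Lemma finite_index_setI {G : groupType} (H K : set G) :
  finite_index_subgroup H -> finite_index_subgroup K ->
  finite_index_subgroup (H `&` K).
Proof.
move=> [hH fH] [hK fK]; split; first exact: subgroup_setI.
apply: (sub_finite_set _ (finite_image2 setI fH fK)).
move=> _ [x _ <-]; exists [set x * h | h in H]; first by exists x.
exists [set x * h | h in K]; first by exists x.
apply/seteqP; split=> [y [[h Hh <-] [k Kk /mulgI ekh]]|_ [h [Hh Kh] <-]].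
  by exists h => //; split=> //; rewrite -ekh.
by split; exists h.
Qed.

(* All cosets of all the subgroups in [s] with representatives in one list [F]
   are allowed, so that a cover by finitely many cosets is exactly this. *)
Definition finitely_covered_by {G : groupType} (s : seq (set G)) :=
  exists F : seq G, forall x,
    exists2 a, a \in F & exists2 K, K \in s & K (a^-1 * x).

(** Induction on the list of subgroups: either the cosets of the head [H] in the cover already
    exhaust the group, or they can be traded for cosets of the other subgroups, with a longer list
    of representatives. *)
Lemma Neumann_covering {G : groupType} (s : seq (set G)) :
  (forall K, K \in s -> subgroup K) -> finitely_covered_by s ->
  exists2 K, K \in s & finite_index_subgroup K.
Proof.
elim: s => [|H s IHs] hs [F hF]; first by have [a _ []] := hF 1.
have hH : subgroup H by apply: hs; rewrite mem_head.
have [[g hg]|nog] := pselect (exists g, forall a, a \in F -> ~ H (a^-1 * g)).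
  (* the coset [g H] is disjoint from the given cosets of [H], hence covered by
     the remaining ones, and each [a H] is a translate of it *)
  have [||K Ks fK] := IHs.
  - by move=> K Ks; apply: hs; rewrite in_cons Ks orbT.
  - exists (F ++ [seq a * g^-1 * b | a <- F, b <- F]) => x.
    have [a aF [K]] := hF x; rewrite in_cons => /orP[/eqP-> Hax|Ks Kax].
      have [b bF [L]] := hF (g * (a^-1 * x)).
      rewrite in_cons => /orP[/eqP-> Hbx|Ls Lbx].
        case: (hg b bF); rewrite -[X in H X](mulgK (a^-1 * x)) -(mulgA b^-1).
        by apply: subgroupM => //; apply: subgroupV.
      exists (a * g^-1 * b).
        by rewrite mem_cat (allpairs_f (fun u v => u * g^-1 * v)) ?orbT.
      by exists L => //; rewrite !invgM invgK -!mulgA.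
    by exists a; [rewrite mem_cat aF|exists K].
  - by exists K => //; rewrite in_cons Ks orbT.
exists H; first exact: mem_head.
split=> //; apply/finite_indexP => //; exists F => x.
apply: contrapT => hx; apply: nog; exists x => a aF Hax.
by apply: hx; exists a.
Qed.

(** Pigeonhole: with n coset representatives, two of x^0, ..., x^n lie in the same coset, so some
    x^d with 0 < d <= n is in [H]. Since d divides n!, the exponent n! serves all x at once. *)
Lemma finite_index_exponent {G : groupType} (H : set G) :
  finite_index_subgroup H ->
  exists2 k, (0 < k)%N & forall x, H (x ^+ k).
Proof.
move=> [hH /finite_indexP-/(_ hH)[F hF]].
exists (size F)`!; first exact: fact_gt0.
move=> x.
have /choice[c cP] (i : nat) : exists a, a \in F /\ H (a^-1 * x ^+ i).
  by have [a] := hF (x ^+ i); exists a.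
have : ~~ uniq [seq c i | i <- iota 0 (size F).+1].
  apply/negP => uc; have : {subset [seq c i | i <- iota 0 (size F).+1] <= F}.
    by move=> _ /mapP[i _ ->]; case: (cP i).
  by move/(uniq_leq_size uc); rewrite size_map size_iota ltnn.
move=> /(uniqPn 1)[i [j [ij]]]; rewrite size_map size_iota => jF.
rewrite !(nth_map 0%N) ?size_iota ?(ltn_trans ij)// !nth_iota ?(ltn_trans ij)//.
rewrite !add0n => ecij.
have Hij : H (x ^+ (j - i)).
  have [_ /(subgroupV _ _ hH) Hi] := cP i; have [_ Hj] := cP j.
  have := subgroupM _ _ _ hH Hi Hj.
  by rewrite ecij invgM invgK -mulgA mulVKg -{1}(subnKC (ltnW ij)) expgnDr mulKg.
have /dvdnP[q ->] : j - i %| (size F)`!.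
  by apply: dvdn_fact; rewrite subn_gt0 ij (leq_trans (leq_subr _ _)).
by rewrite mulnC expgnA; apply: subgroupX.
Qed.

Lemma finite_index_avoiding {G : groupType} (s : seq G) :
  residually_finite G -> 1 \notin s ->
  exists2 H : set G, finite_index_subgroup H & forall x, x \in s -> ~ H x.
Proof.
move=> rf; elim: s => [_|x s IHs].
  exists setT => //; have hT : subgroup [set: G] by exact: subgroup_intro.
  split=> //; apply/finite_indexP => //; exists [:: 1] => x; exists 1 => //.
  exact: mem_head.
rewrite in_cons negb_or => /andP[x1 /IHs[H fH Hs]].
have [K fK Kx] : exists2 K : set G, finite_index_subgroup K & ~ K x.
  apply: contrapT => nK; move: x1; suff : [set 1] x by move=> /= ->; rewrite eqxx.
  rewrite -rf => K /= fK; apply: contrapT => Kx; apply: nK; exists K => //.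
exists (H `&` K); first exact: finite_index_setI.
by move=> y; rewrite in_cons => /orP[/eqP->|/Hs Hy] [].
Qed.

(** Choose [H] to avoid x^-1 y for all distinct x, y in a set of at least [N] elements: these then
    lie in distinct cosets of every [L] inside [H]. The bound is stated for all such [L] because the
    subgroup of small rank found later is only contained in [H]. *)
Lemma exists_large_index {G : groupType} (N : nat) :
  infinite_set [set: G] -> residually_finite G ->
  exists2 H : set G, finite_index_subgroup H &
    forall L, L `<=` H -> finite_index_subgroup L -> (N <= subgroup_index L)%N.
Proof.
move=> /(infinite_set_fset N)[B _ NB] rf.
pose s := [seq x^-1 * y | x <- B, y <- [seq y <- B | y != x]].
have [|H fH Hs] := finite_index_avoiding s rf.
  apply/allpairsPdep => -[x [y [_]]]; rewrite mem_filter => /andP[yx _].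
  by move=> /esym /(canRL (mulVKg _)); rewrite mulg1; apply/eqP.
exists H => // L LH [hL fL]; apply: (leq_trans NB).
have inj : {in B &, injective (fun x => [set x * h | h in L])}.
  move=> x y Bx By /(lcoset_eq _ _ _ hL)/LH Hxy; apply/eqP.
  apply: contraT => nxy; case: (Hs (x^-1 * y)) => //.
  by apply: allpairs_f_dep => //; rewrite mem_filter eq_sym nxy.
rewrite -(card_in_imfset imfset_key inj); apply: fsubset_leq_card.
apply/fsubsetP => _ /imfsetP[x _ ->]; rewrite in_fset_set //= inE.
by exists x.
Qed.

(** * Subgroups of bounded rank from bounded generation *)

(* For [s = i_1 ... i_m], the elements [p_j * g i_j ^+ k * p_j^-1] with
   [p_j = g i_1 ^+ r i_1 * ... * g i_(j-1) ^+ r i_(j-1)]. *)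
Fixpoint conj_powers {G : groupType} {I : Type} (k : nat) (g : I -> G)
    (r : I -> nat) (s : seq I) : seq G :=
  if s is i :: s' then
    g i ^+ k :: [seq y ^ (g i ^- r i) | y <- conj_powers k g r s']
  else [::].

Lemma size_conj_powers {G : groupType} {I : Type} k (g : I -> G) r s :
  size (conj_powers k g r s) = size s.
Proof. by elim: s => //= i s IHs; rewrite size_map IHs. Qed.

(** A conjugate of a k-th power is a k-th power; this puts the generators in [H] even when [H] is
    not normal. *)
Lemma conj_powersP {G : groupType} {I : Type} k (g : I -> G) r s y :
  y \in conj_powers k g r s -> exists z, y = z ^+ k.
Proof.
elim: s y => //= i s IHs y; rewrite in_cons => /orP[/eqP->|]; first by exists (g i).
by move=> /mapP[_ /IHs[z ->] ->]; exists (z ^ (g i ^- r i)); rewrite conjXg.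
Qed.

(** The residue is chosen before [L], since the subgroups to which this is applied are themselves
    built from the residues. *)
Lemma expgz_residue {G : groupType} (x : G) (a : int) (k : nat) : (0 < k)%N ->
  exists r : 'I_k, forall L, subgroup L -> L (x ^+ k) ->
    L (expgz x a * x ^- r).
Proof.
move=> k0; case: a => n /=.
  exists (Ordinal (ltn_pmod n k0)) => L hL Lx /=.
  rewrite {1}(divn_eq n k) expgnDr mulgK mulnC expgnA; exact: subgroupX.
(* [n.+1 + r] is a multiple of [k] *)
have [q eq] : exists q, (n.+1 + (k - n.+1 %% k) %% k = q * k)%N.
  apply/dvdnP; rewrite /dvdn modnDmr -modnDml subnKC ?modnn//.
  exact/ltnW/ltn_pmod.
(* The outer reduction is for the case where k divides n+1: the difference is then k itself, which
   is out of range. *)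
exists (Ordinal (ltn_pmod (k - n.+1 %% k) k0)) => L hL Lx.
rewrite -invgM -expgnDr addnC eq mulnC expgnA.
by apply: subgroupV => //; apply: subgroupX.
Qed.

(** Splitting off the first factor conjugates the remaining quotient by [g i ^- r i], so the
    induction hypothesis is applied to the preimage of [L] under that conjugation; hence [L] varies
    in the induction. *)
Lemma prod_residue {G : groupType} {I : Type} k (g : I -> G) (e : I -> G) r
    (s : seq I) (L : set G) :
  (forall i L, subgroup L -> L (g i ^+ k) -> L (e i * g i ^- r i)) ->
  subgroup L -> (forall y, y \in conj_powers k g r s -> L y) ->
  L ((\prod_(i <- s) e i) * (\prod_(i <- s) g i ^+ r i)^-1).
Proof.
move=> he; elim: s L => [|i s IHs] L hL Ls.
  by rewrite !big_nil mulgV; apply: subgroup1.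
rewrite !big_cons invgM.
have -> (a b p q : G) : a * p * (q^-1 * b^-1) = (a * b^-1) * (p * q^-1) ^ b^-1.
  by rewrite conjgE invgK !mulgA mulgVK.
apply: subgroupM => //; first by apply: he => //; apply: Ls; rewrite mem_head.
apply: (IHs [set x | L (x ^ (g i ^- r i))]); first exact: subgroup_preimJ.
by move=> y ys /=; apply: Ls; rewrite in_cons (map_f (conjg^~ _)) ?orbT.
Qed.

Lemma exists_finite_index_generated {G : groupType} (m : nat) (g : 'I_m -> G)
    (H : set G) :
  (forall x, exists a : 'I_m -> int, x = \prod_(i < m) expgz (g i) (a i)) ->
  finite_index_subgroup H ->
  exists s : seq G, [/\ (size s <= m)%N, generated [set` s] `<=` H &
    finite_index_subgroup (generated [set` s])].
Proof.
move=> bg fH; have [hH _] := fH.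
have [k k0 Hk] := finite_index_exponent H fH.
pose gens (r : {ffun 'I_m -> 'I_k}) :=
  conj_powers k g (fun i => nat_of_ord (r i)) (index_enum 'I_m).
pose L r := generated [set` gens r].
have [||K] := Neumann_covering [seq L r | r : {ffun 'I_m -> 'I_k}].
- by move=> _ /mapP[r _ ->]; apply: subgroup_generated.
- exists [seq (\prod_i g i ^+ r i)^-1 | r : {ffun 'I_m -> 'I_k}] => x.
  (* [prod_residue] locates an element in a right coset [L f * p]. Expanding the inverse of x turns
     this into the left coset [p^-1 * L f] containing x. *)
  have [a ea] := bg x^-1.
  have /choice[r hr] (i : 'I_m) : exists r : 'I_k, forall L, subgroup L ->
      L (g i ^+ k) -> L (expgz (g i) (a i) * g i ^- r).
    exact: expgz_residue.
  pose f := [ffun i => r i].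
  exists (\prod_i g i ^+ f i)^-1; first by apply/mapP; exists f; rewrite ?mem_enum.
  exists (L f); first by apply/mapP; exists f; rewrite ?mem_enum.
  rewrite -[X in L f X]invgK; apply: (subgroupV (L f)); first exact: subgroup_generated.
  rewrite invgM invgK ea.
  apply: (prod_residue k g (fun i => expgz (g i) (a i)) (fun i => f i)).
  + by move=> i M; rewrite ffunE; apply: hr.
  + exact: subgroup_generated.
  + by move=> y ys; apply: sub_gen_smallest.
- move=> /mapP[r _ ->] fL; exists (gens r); split=> //.
    by rewrite size_conj_powers -sum1_size sum1_card card_ord.
  apply: smallest_sub => // y /= /conj_powersP[z ->]; exact: Hk.
Qed.

(** * Rank estimates and the rank gradient *)

Local Open Scope ereal_scope.

Lemma card_fset_set_seq {T : choiceType} (s : seq T) :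
  (#|` fset_set [set` s]| <= size s)%N.
Proof.
have -> : fset_set [set` s] = [fset x in s]%fset.
  apply/fsetP => x; rewrite in_fset_set; last exact: finite_seq.
  by rewrite mem_setE inE.
by rewrite card_fseq size_undup.
Qed.

Lemma rank_generated_le (R : realType) {G : groupType} (s : seq G) :
  rank R (generated [set` s]) <= (size s)%:R%:E.
Proof.
apply: (@le_trans _ _ (#|` fset_set [set` s] |%:R)%:E).
  by apply: ereal_inf_lbound; exists [set` s].
rewrite lee_fin ler_nat.
exact: card_fset_set_seq.
Qed.

(** An empty generating set would make [H] trivial, and a group with a trivial subgroup of finite
    index is finite. *)
Lemma rank_ge1 (R : realType) {G : groupType} (H : set G) :
  infinite_set [set: G] -> finite_index_subgroup H -> 1 <= rank R H.
Proof.
move=> Ginf [hH fH]; apply: le_ereal_inf_tmp => _ [S [fS eS] <-].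
rewrite lee_fin ler1n lt0n cardfs_eq0; apply/eqP => /(fset_set_set0 fS) S0.
apply: Ginf; have H1 : H `<=` [set 1%g].
  by rewrite -eS; apply: smallest_sub; [exact: subgroup_set1|rewrite S0].
have /finite_indexP-/(_ hH)[F hF] := fH.
apply: (sub_finite_set _ (finite_seq F)) => x _ /=.
by have [a aF /H1/(canRL (mulVKg _))] := hF x; rewrite mulg1 => ->.
Qed.

Lemma rank_gradient_ge0 (R : realType) {G : groupType} :
  infinite_set [set: G] -> 0 <= rank_gradient R G.
Proof.
move=> Ginf; apply: le_ereal_inf_tmp => _ [H fH <-].
by rewrite mule_ge0 ?inve_ge0 ?lee_fin// sube_ge0 ?orbT// rank_ge1.
Qed.


Theorem mainTheorem3 (R : realType) (G : groupType)
    (Ginf : infinite_set [set: G])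
    (Grf : residually_finite G)
    (Gbg : boundedly_generated G) :
  rank_gradient R G = 0.
Proof.
apply/eqP; rewrite eq_le rank_gradient_ge0// andbT.
have [m [g [_ bg]]] := Gbg.
apply/lee_addgt0Pr => _/posnumP[e]; rewrite add0e.
(* With this [N], m/e < N, so any index at least [N] brings the quotient m / index below e. *)
pose N := (Num.truncn (m%:R / e%:num)).+1.
have [H fH largeH] := exists_large_index N Ginf Grf.
have [s [sm sH fs]] := exists_finite_index_generated m g H bg fH.
have Ns := largeH _ sH fs.
set L := generated _ in sH fs Ns.
have rL : rank R L - 1 <= m%:R%:E.
  rewrite leeBlDr// (le_trans (rank_generated_le R s))// -EFinD lee_fin.
  by rewrite natr1 ler_nat ltnW.
(* Positivity, which holds as [N] is a successor, makes the extended inverse of the index a real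
   inverse rather than its value at 0. *)
have n0 : (0 < subgroup_index L)%N by apply: leq_trans Ns.
apply: (@le_trans _ _ ((rank R L - 1) / (subgroup_index L)%:R%:E)).
  by apply: ereal_inf_lbound; exists L.
apply: (@le_trans _ _ (m%:R%:E / (subgroup_index L)%:R%:E)).
  by apply: lee_wpmul2r => //; rewrite inve_ge0 lee_fin.
rewrite inver pnatr_eq0 eqn0Ngt n0 -EFinM lee_fin.
rewrite ler_pdivrMr ?ltr0n// mulrC -ler_pdivrMr//.
rewrite (le_trans (ltW (truncnS_gt _)))//.
by rewrite ler_nat.
Qed.
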